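(* Let $\Delta$ be a simplicial complex on $[n]=\{1,\ldots,n\}$ with facets $F_1,\ldots,F_r$, and let $\Gamma\subset\mathbb N_\infty^n$ be the multicomplex with facets $a_{F_1},\ldots,a_{F_r}$, where for $F\subset[n]$ the element $a_F\in\mathbb N_\infty^n$ is defined by $a_F(i)=\infty$ if $i\in F$ and $a_F(i)=0$ otherwise. Then the simplicial complex $\Delta$ is $k$-decomposable if and only if the multicomplex $\Gamma$ is $k$-decomposable.
   Context: Simplicial complexes. For a simplicial complex $\Delta$ on vertex set $X$ and $F\in\Delta$: $\mathrm{link}_\Delta(F)=\{G\in\Delta: G\cap F=\emptyset,\ G\cup F\in\Delta\}$ and $\Delta\setminus F=\{G\in\Delta: F\nsubseteq G\}$. A face $\sigma$ is a shedding face if every face $\tau\supseteq\sigma$ satisfies: for every $v\in\sigma$ there is $w\in X\setminus\tau$ such that $(\tau\cup\{w\})\setminus\{v\}$ is a face of $\Delta$. $\Delta$ is recursively defined to be $k$-decomposable if either $\Delta$ is a simplex or else it has a shedding face $\sigma$ with $\dim(\sigma)\le k$ such that both $\Delta\setminus\sigma$ and $\mathrm{link}_\Delta(\sigma)$ are $k$-decomposable; the complexes $\{\}$ and $\{\emptyset\}$ are considered $k$-decomposable for all $k\ge -1$. Multicomplexes. Let $\mathbb N$ be the set of non-negative integers and $\mathbb N_\infty=\mathbb N\cup\{\infty\}$. Order $\mathbb N_\infty^n$ by $a\preceq b$ iff $a(i)\le b(i)$ for all $i$. For $a\in\mathbb N_\infty^n$ put $\mathrm{fpt}(a)=\{i:a(i)\neq\infty\}$,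 $\mathrm{infpt}(a)=\{i:a(i)=\infty\}$, $\mathrm{fpt}^\ast(a)=\{i:0<a(i)<\infty\}$. For $\Gamma\subset\mathbb N_\infty^n$ let $\mathcal M(\Gamma)$ be the set of maximal elements of $\Gamma$ with respect to $\preceq$. $\Gamma$ is a multicomplex if (1) $a\in\Gamma$ and $b\preceq a$ imply $b\in\Gamma$; (2) for every $a\in\Gamma$ there is $m\in\mathcal M(\Gamma)$ with $a\preceq m$. Elements of $\Gamma$ are called faces. A face $a\in\Gamma$ is a facet if $\mathrm{infpt}(a)=\mathrm{infpt}(m)$ for all $m\in\mathcal M(\Gamma)$ with $a\preceq m$; $\mathcal F(\Gamma)$ is the set of facets. For $A\subset\mathbb N_\infty^n$, $\langle A\rangle$ denotes the smallest multicomplex containing $A$. Put $\dim(a)=|\mathrm{infpt}(a)|-1$ and $\dim(\Gamma)=\max\{\dim(a):a\in\Gamma\}$. A Stanley set of degree $a$ (with $a\in\mathbb N^n$) is a set of the form $a+\langle m\rangle$ for some $m\in\{0,\infty\}^n$. For $a\in\Gamma$ define $\mathrm{star}_\Gamma a=\langle b\in\mathcal F(\Gamma): a\preceq b\rangle$, $\Gamma\setminus a=\langle b\in\mathcal F(\Gamma): a\not\preceq b\rangle$, $\mathrm{link}_\Gamma a=\langle b-a: b\in\mathcal F(\Gamma),\ a\preceq b\rangle$ (coordinatewise subtraction, $\infty-c=\infty$ for $c\in\mathbb N$). Shedding face of a multicomplex: let $\Gamma$ be a $(d-1)$-dimensional multicomplex and $0\le k\le d-1$. An element $a\in\Gamma\cap\mathbb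 N^n$ with $|\mathrm{fpt}^\ast(a)|\le k+1$ is a shedding face if (i) for all $b\in\mathcal F(\mathrm{star}_\Gamma a)$, $\langle b\rangle\setminus(\Gamma\setminus a)$ is a Stanley set of degree $a$; (ii) for every $b\in\mathcal F(\mathrm{star}_\Gamma a)$ and every $c\in\mathcal F(\Gamma\setminus a)$, if $\mathrm{fpt}(b)\subseteq\mathrm{fpt}(c)$ then $\mathrm{fpt}(b)=\mathrm{fpt}(c)$. $k$-decomposable multicomplex: let $\Gamma$ be a $(d-1)$-dimensional multicomplex and $0\le k\le d-1$. $\Gamma$ is (recursively) $k$-decomposable if it has only one facet or there exists a shedding face $a\in\Gamma$ with $|\mathrm{fpt}^\ast(a)|\le k+1$ such that both $\mathrm{link}_\Gamma a$ and $\Gamma\setminus a$ are $k$-decomposable. *)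

(* Defs.v *)
From HB Require Import structures.
From mathcomp Require Import all_boot.

Set Implicit Arguments.
Unset Strict Implicit.
Unset Printing Implicit Defensive.

Section SimplicialComplexes.

Variable n : nat.
Implicit Types (D : {set {set 'I_n}}) (F G s t : {set 'I_n}).

(* Vertices need not be faces, so that links and deletions are again complexes
   on 'I_n.  The void complex set0 differs from the complex [set set0]. *)
Definition simplicial_complex D : Prop :=
  forall F G, F \in D -> G \subset F -> G \in D.

Definition sfacets D : {set {set 'I_n}} :=
  [set F | maxset [in D] F]%SET.

Definition slink D F : {set {set 'I_n}} :=
  [set G in D | [disjoint G & F] && (G :|: F \in D)]%SET.

Definition sdel D F : {set {set 'I_n}} :=
  [set G in D | ~~ (F \subset G)]%SET.

Definition sshedding D s : Prop :=
  s \in D /\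
  forall t, t \in D -> s \subset t -> forall v, v \in s ->
    exists2 w, w \notin t & (t :|: [set w]%SET) :\ v \in D.

(* dim s <= k is expressed as #|s| <= k.+1; the complex [set set0] is the
   simplex powerset set0. *)
Inductive skdecomposable (k : nat) : {set {set 'I_n}} -> Prop :=
| skdec_void : skdecomposable k set0
| skdec_simplex F : skdecomposable k (powerset F)
| skdec_shed D s : sshedding D s -> #|s| <= k.+1 ->
    skdecomposable k (sdel D s) -> skdecomposable k (slink D s) ->
    skdecomposable k D.

End SimplicialComplexes.

From mathcomp Require Import classical_sets.

(* N_oo: [Some p] is the natural number p, [None] is infinity. *)
Definition le_oo (x y : option nat) : bool :=
  match x, y with
  | _, None => true
  | None, Some _ => false
  | Some p, Some q => p <= q
  end.

Definition add_oo (x y : option nat) : option nat :=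
  match x, y with
  | Some p, Some q => Some (p + q)
  | _, _ => None
  end.

(* Only used with y finite and y <= x; oo - q = oo. *)
Definition sub_oo (x y : option nat) : option nat :=
  match x, y with
  | None, _ => None
  | Some p, Some q => Some (p - q)
  | Some _, None => Some 0
  end.

Notation vec_oo n := {ffun 'I_n -> option nat}.

Section Multicomplexes.

Local Open Scope classical_set_scope.

Variable n : nat.
Implicit Types (a b c m : vec_oo n) (A Gam S : set (vec_oo n)).

Definition lev a b : bool := [forall i, le_oo (a i) (b i)].

Definition addv a b : vec_oo n := [ffun i => add_oo (a i) (b i)].

Definition subv a b : vec_oo n := [ffun i => sub_oo (a i) (b i)].

Definition fpt a : {set 'I_n} := [set i | a i != None]%SET.

Definition infpt a : {set 'I_n} := [set i | a i == None]%SET.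

Definition fpt_star a : {set 'I_n} :=
  [set i | (a i != None) && (a i != Some 0)]%SET.

(* Membership in N^n. *)
Definition finite_vec a : Prop := forall i, a i <> None.

Definition maximal_elts Gam : set (vec_oo n) :=
  [set m | Gam m /\ forall b, Gam b -> lev m b -> b = m].

Definition multicomplex Gam : Prop :=
  (forall a b, Gam a -> lev b a -> Gam b) /\
  (forall a, Gam a -> exists2 m, maximal_elts Gam m & lev a m).

Definition mfacets Gam : set (vec_oo n) :=
  [set a | Gam a /\
    forall m, maximal_elts Gam m -> lev a m -> infpt a = infpt m].

(* <A>.  Multicomplexes are stable under arbitrary intersections (they are the
   lower sets closed under suprema of chains), hence [smallest], which is an
   intersection, is the smallest multicomplex containing A. *)
Definition mgen A : set (vec_oo n) := smallest multicomplex A.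

Definition mstar Gam a : set (vec_oo n) :=
  mgen [set b | mfacets Gam b /\ lev a b].

Definition mdel Gam a : set (vec_oo n) :=
  mgen [set b | mfacets Gam b /\ ~ lev a b].

Definition mlink Gam a : set (vec_oo n) :=
  mgen [set subv b a | b in [set b | mfacets Gam b /\ lev a b]].

Definition stanley_set a S : Prop :=
  exists m, (forall i, m i = Some 0 \/ m i = None) /\
    S = [set addv a u | u in mgen [set m]].

Definition mshedding (k : nat) Gam a : Prop :=
  [/\ Gam a, finite_vec a, #|fpt_star a| <= k.+1,
      forall b, mfacets (mstar Gam a) b ->
        stanley_set a (mgen [set b] `\` mdel Gam a) &
      forall b c, mfacets (mstar Gam a) b -> mfacets (mdel Gam a) c ->
        fpt b \subset fpt c -> fpt b = fpt c].

(* No bound of k by the dimension is imposed, since the recursion keeps k fixed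
   while the dimension of links and deletions may drop. *)
Inductive mkdecomposable (k : nat) : set (vec_oo n) -> Prop :=
| mkdec_facet Gam b : mfacets Gam = [set b] -> mkdecomposable k Gam
| mkdec_shed Gam a : mshedding k Gam a ->
    mkdecomposable k (mlink Gam a) -> mkdecomposable k (mdel Gam a) ->
    mkdecomposable k Gam.

Definition vec_of_face (F : {set 'I_n}) : vec_oo n :=
  [ffun i => if i \in F then None else Some 0].

End Multicomplexes.

(* Main.v *)
Require Import Defs.
From mathcomp Require Import all_boot.

Set Implicit Arguments.
Unset Strict Implicit.
Unset Printing Implicit Defensive.

(** The multicomplex attached to D is [gam D], the set of vectors whose support
    is a face of D.  A finite vector a only enters star, link and deletion of
    [gam D] through its support s: the deletion is generated by the facets not
    containing s, and since oo - c = oo the link is the whole star of s, i.e. a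
    cone over the simplicial link.  For facets F containing s,
    [<a_F> \ (gam D \ a)] is a Stanley set of degree a exactly when every F - v
    with v in s lies in a facet not containing s, which is the shedding
    condition; condition (ii) on facets always holds here.  As links become
    cones, the equivalence is proved by induction for all cones over D. *)

(** * Stars, facet deletions and cones of simplicial complexes *)

Section Complexes.

Variable n : nat.
Implicit Types (D C : {set {set 'I_n}}) (F G s e : {set 'I_n}).

Lemma sfacetP D F :
  reflect (F \in D /\ forall G, G \in D -> F \subset G -> G = F)
    (F \in sfacets D).
Proof.
rewrite inE; apply: (iffP maxsetP) => -[FD maxF]; split=> // G GD FG;
  exact: maxF.
Qed.

Lemma sub_sfacet D G : G \in D -> exists2 F, F \in sfacets D & G \subset F.
Proof.
move=> GD; have [F maxF GF] := @maxset_exists _ [in D] G GD.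
by exists F; rewrite // inE.
Qed.

Definition sstar D s : {set {set 'I_n}} := [set G | G :|: s \in D]%SET.

(** The simplicial counterpart of [mdel], generated by facets. It can be smaller than [sdel D s]: a
    face not containing s is lost when all facets around it contain s. *)
Definition sfdel D s : {set {set 'I_n}} :=
  [set G : {set 'I_n} | [exists F in sfacets D, ~~ (s \subset F) && (G \subset F)]]%SET.

(* The join of D with the simplex on e, when the faces of D avoid e. *)
Definition cone e D : {set {set 'I_n}} := [set G | G :\: e \in D]%SET.

Lemma sfdelP D s G :
  reflect (exists F, [/\ F \in sfacets D, ~~ (s \subset F) & G \subset F])
    (G \in sfdel D s).
Proof.
rewrite inE; apply: (iffP exists_inP) => [[F FD /andP[]]|[F [? ? ?]]];
  by exists F => //; apply/andP.
Qed.

Lemma sdel_complex D s : simplicial_complex D -> simplicial_complex (sdel D s).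
Proof.
move=> cD F G; rewrite !inE => /andP[FD sF] GF.
by rewrite (cD F) //=; apply: contra sF => /subset_trans; apply.
Qed.

Lemma slink_complex D s :
  simplicial_complex D -> simplicial_complex (slink D s).
Proof.
move=> cD F G; rewrite !inE => /and3P[FD Fs FsD] GF.
by rewrite (cD F G) // (disjointWl GF Fs) /= (cD _ _ FsD) // setSU.
Qed.

Lemma sstar_complex D s :
  simplicial_complex D -> simplicial_complex (sstar D s).
Proof. by move=> cD F G; rewrite !inE => FD GF; apply: cD FD _; rewrite setSU. Qed.

Lemma sfdel_complex D s : simplicial_complex (sfdel D s).
Proof.
move=> F G /sfdelP[H [? ? FH]] GF; apply/sfdelP; exists H; split=> //.
exact: subset_trans FH.
Qed.

Lemma cone_complex e D : simplicial_complex D -> simplicial_complex (cone e D).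
Proof. by move=> cD F G; rewrite !inE => FD GF; apply: cD FD _; rewrite setSD. Qed.

(** Let G be a face missing some v in s, inside a facet F that contains s. Shedding exchanges v for
    some w outside F. A facet H around the result cannot contain v, since it would then contain F
    and w, against the maximality of F. So H avoids v and still contains G. *)
Lemma sfdel_sshedding D s : simplicial_complex D -> sshedding D s ->
  sfdel D s = sdel D s.
Proof.
move=> cD [sD shed]; apply/setP => G; apply/sfdelP/idP => [[F [FD sF GF]]|].
  case/sfacetP: FD => FD _; rewrite inE (cD F) //=.
  by apply: contra sF => /subset_trans; apply.
rewrite inE => /andP[GD sG]; have [F Ffac GF] := sub_sfacet GD.
have [sF|?] := boolP (s \subset F); last by exists F.
have [v vs vG] := subsetPn sG; have /sfacetP[FD maxF] := Ffac.
have [w wF FwD] := shed F FD sF v vs; have [H Hfac FwH] := sub_sfacet FwD.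
exists H; split=> //.
  apply/negP => sH; have /sfacetP[HD _] := Hfac.
  have FH : F \subset H.
    apply/subsetP => i iF; have [->|iv] := eqVneq i v; first exact: (subsetP sH).
    by apply: (subsetP FwH); rewrite !inE iv iF.
  have wv : w != v by apply: contraNneq wF => ->; apply: (subsetP sF).
  move: wF; rewrite -(maxF H HD FH) (subsetP FwH) // !inE wv eqxx.
  by rewrite orbT.
apply/subsetP => i iG; apply: (subsetP FwH).
rewrite !inE (subsetP GF) // andbT; by apply: contraNneq vG => <-.
Qed.

(** * Shedding faces, deletions and stars of a cone *)

Section Cone.

Variables (e : {set 'I_n}) (D : {set {set 'I_n}}).
Hypothesis D_complex : simplicial_complex D.
Hypothesis D_disj : forall G, G \in D -> [disjoint G & e].

Lemma sub_cone G : G \in D -> G \in cone e D.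
Proof. by move=> GD; rewrite inE; apply: D_complex GD (subsetDl _ _). Qed.

Lemma setU_cone G : (G :|: e \in cone e D)%SET = (G :\: e \in D)%SET.
Proof. by rewrite inE setDUl setDv setU0. Qed.

Lemma setDidl_disj G : G \in D -> (G :\: e)%SET = G.
Proof. by move=> /D_disj /setDidPl. Qed.

Lemma notin_disj G i : G \in D -> i \in G -> i \notin e.
Proof. by move=> /D_disj /disjointFr h /h ->. Qed.

(** Apex vertices lie in every facet of the cone, so none of them can be exchanged; away from the
    apex, exchanges in the cone and in D correspond by adding or removing e. *)
Lemma sshedding_cone s :
  sshedding (cone e D) s <-> [disjoint s & e] /\ sshedding D s.
Proof.
split=> [[sC shed]|[se [sD shed]]].
  have se : [disjoint s & e].
    apply/pred0P => v; apply/negP => /andP[/= vs ve].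
    have [F /sfacetP[FC maxF] sF] := sub_sfacet sC.
    have [w wF FwC] := shed F FC sF v vs.
    (* As v lies in e, removing it does not affect membership in the cone, so F could be enlarged by
       w. *)
    have Fw : (w |: F)%SET \in cone e D.
      move: FwC; rewrite !inE; congr (_ \in D); apply/setP => i.
      rewrite !inE; have [->|_] := eqVneq i v; first by rewrite ve.
      by rewrite orbC.
    by move: wF; rewrite -(maxF _ Fw (subsetUr _ _)) setU11.
  split=> //; have sD : s \in D.
    by move: sC; rewrite inE; move/setDidPl: se => ->.
  split=> // t tD st v vs.
  (* Enlarging t by the whole apex forces the new vertex w out of e, so w survives when e is removed
     again. *)
  have teC : (t :|: e)%SET \in cone e D by rewrite setU_cone setDidl_disj.
  have [w] := shed _ teC (subset_trans st (subsetUl _ _)) v vs.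
  rewrite !inE => /norP[wt we] H; exists w => //.
  move: H; congr (_ \in D); apply/setP => i; rewrite !inE.
  have [ie|ie] /= := boolP (i \in e); last by rewrite orbF.
  have -> : (i \in t) = false.
    by apply/negP => /(notin_disj tD); rewrite ie.
  have -> : (i == w) = false by apply: contraNF we => /eqP <-.
  by rewrite andbF.
split; first exact: sub_cone.
move=> t; rewrite inE => tD st v vs.
have st' : s \subset (t :\: e)%SET by rewrite subsetD st.
have [w wt twD] := shed _ tD st' v vs.
have vt := subsetP st' v vs.
have wv : w != v by apply: contraNneq wt => ->.
have we : w \notin e by apply: (notin_disj twD); rewrite !inE wv eqxx orbT.
exists w; first by move: wt; rewrite !inE we.
rewrite inE; move: twD; congr (_ \in D); apply/setP => i; rewrite !inE.
have [->|iw] := eqVneq i w; first by rewrite !orbT we.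
by rewrite !orbF andbCA.
Qed.

Lemma sdel_cone s : [disjoint s & e] ->
  sdel (cone e D) s = cone e (sdel D s).
Proof. by move=> se; apply/setP => G; rewrite !inE subsetD se andbT. Qed.

(** The star of s is the join of s with its link, so the apex grows from e to the union of s and
    e. *)
Lemma sstar_cone s : [disjoint s & e] ->
  sstar (cone e D) s = cone (s :|: e)%SET (slink D s).
Proof.
move=> se; apply/setP => G; rewrite !inE.
have -> : [disjoint G :\: (s :|: e) & s]%SET.
  apply/pred0P => i; rewrite /= !inE; by case: (i \in s); rewrite ?andbF.
have -> : ((G :|: s) :\: e = (G :\: (s :|: e)) :|: s)%SET.
  apply/setP => i; rewrite !inE; case: (boolP (i \in s)) => [/(disjointFr se) -> //|_].
    by rewrite !orbT.
  by rewrite !orbF.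
rewrite /= andbC; case: (boolP (_ :|: s \in D)%SET) => //= H.
by rewrite (D_complex H) // subsetUl.
Qed.

End Cone.

Lemma slink0 D : slink D set0 = D.
Proof.
apply/setP => G; rewrite inE setU0.
by rewrite -setI_eq0 setI0 eqxx andbb.
Qed.

Lemma cone0 D : cone set0 D = D.
Proof. by apply/setP => G; rewrite inE setD0. Qed.

End Complexes.

From mathcomp Require Import classical_sets.

Local Open Scope classical_set_scope.

(** * Multicomplexes given by supports *)

Section Support.

Variable n : nat.
Implicit Types (D C : {set {set 'I_n}}) (F G s e : {set 'I_n}).
Implicit Types (a b x : vec_oo n).

(** Infinite entries count as well; on finite vectors this agrees with [fpt_star]. *)
Definition supp x : {set 'I_n} := [set i | x i != Some 0]%SET.

Definition gam D : set (vec_oo n) := [set x | supp x \in D].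

(** The least vector with support s: x lies above it exactly when the support of x contains s. *)
Definition indic s : vec_oo n := [ffun i => Some (i \in s : nat)].

Lemma supp_face F : supp (vec_of_face F) = F.
Proof. by apply/setP => i; rewrite inE ffunE; case: ifP. Qed.

Lemma supp_indic s : supp (indic s) = s.
Proof. by apply/setP => i; rewrite inE ffunE; case: (i \in s). Qed.

Lemma infpt_face F : infpt (vec_of_face F) = F.
Proof. by apply/setP => i; rewrite inE ffunE; case: ifP. Qed.

Lemma fpt_face F : fpt (vec_of_face F) = (~: F)%SET.
Proof. by apply/setP => i; rewrite !inE ffunE; case: ifP. Qed.

Lemma vec_of_face_inj : injective (@vec_of_face n).
Proof. by move=> F G /(congr1 supp); rewrite !supp_face. Qed.

Lemma lev_face x F : lev x (vec_of_face F) = (supp x \subset F).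
Proof.
apply/forallP/fintype.subsetP => H i; have := H i; rewrite ffunE inE.
  by case: ifP => // _; case: (x i) => [[|p]|].
by case: ifP => _; case: (x i) => [[|p]|] //= /(_ isT).
Qed.

Lemma lev_supp a x : lev a x -> supp a \subset supp x.
Proof.
move=> /forallP ax; apply/fintype.subsetP => i; have := ax i; rewrite !inE.
by case: (a i) (x i) => [[|p]|] [[|q]|].
Qed.

Lemma fpt_star_supp a : finite_vec a -> fpt_star a = supp a.
Proof.
move=> fa; apply/setP => i; rewrite !inE.
by have /eqP -> := fa i.
Qed.

Lemma subv_face a F : finite_vec a -> lev a (vec_of_face F) ->
  subv (vec_of_face F) a = vec_of_face F.
Proof.
move=> fa; rewrite lev_face => /fintype.subsetP aF; apply/ffunP => i; rewrite !ffunE.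
have := fa i; have := aF i; rewrite inE; case: ifP => // _.
by case: (a i) => [p|].
Qed.

Lemma gam_face D F : gam D (vec_of_face F) = (F \in D).
Proof. by rewrite /gam /= supp_face. Qed.

(** Every x lies below [vec_of_face (supp x)], which has the same support and so is again in
    [gam D]. *)
Lemma maximal_gam D : simplicial_complex D ->
  maximal_elts (gam D) = [set vec_of_face F | F in [set` sfacets D]].
Proof.
move=> cD; apply/seteqP; split=> [m [mD maxm]|_ [F /sfacetP[FD maxF] <-]].
  have Em : vec_of_face (supp m) = m.
    by apply: maxm; rewrite ?gam_face // lev_face.
  exists (supp m) => //; apply/sfacetP; split=> // G GD mG.
  by rewrite -(supp_face G) (maxm (vec_of_face G)) ?gam_face // lev_face.
split; first by rewrite gam_face.
move=> b bD Fb; have := lev_supp Fb; rewrite supp_face => /(maxF _ bD) Eb.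
apply/ffunP => i; have /forallP/(_ i) := Fb; rewrite !ffunE -Eb inE.
by have [->|_] := eqVneq (b i) (Some 0); last case: (b i).
Qed.

Lemma gam_multicomplex D : simplicial_complex D -> multicomplex (gam D).
Proof.
move=> cD; split=> [a b aD /lev_supp ba|a aD]; first exact: cD aD ba.
have [F FD aF] := sub_sfacet aD; rewrite maximal_gam //.
by exists (vec_of_face F); [exists F | rewrite lev_face].
Qed.

(** If the support of a facet b lies in F, a facet of D, then b is infinite exactly on F and 0
    elsewhere. Thus all facets of [gam D] are maximal. *)
Lemma mfacets_gam D : simplicial_complex D ->
  mfacets (gam D) = [set vec_of_face F | F in [set` sfacets D]].
Proof.
move=> cD; rewrite /mfacets maximal_gam //; apply/seteqP; split.
  move=> b [bD H]; have [F FD bF] := sub_sfacet bD.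
  exists F => //; have Eb : infpt b = F.
    by rewrite (H (vec_of_face F)) ?infpt_face ?lev_face //; exists F.
  apply/ffunP => i; rewrite ffunE; case: ifP => [|/negbT iF].
    by rewrite -Eb inE => /eqP.
  by have := contra (fintype.subsetP bF i) iF; rewrite inE negbK => /eqP.
move=> _ [F Ffac <-]; have /sfacetP[FD maxF] := Ffac.
split; first by rewrite gam_face.
move=> _ [G /sfacetP[GD _] <-]; rewrite lev_face supp_face => FG.
by rewrite (maxF G).
Qed.

Lemma mgen_face (A : {set {set 'I_n}}) D : simplicial_complex D ->
    (forall G, G \in D <-> exists2 F, F \in A & G \subset F) ->
  mgen [set vec_of_face F | F in [set` A]] = gam D.
Proof.
move=> cD AD; apply/seteqP; split.
  apply: smallest_sub; first exact: gam_multicomplex.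
  by move=> _ [F /= FA <-]; rewrite gam_face; apply/AD; exists F.
move=> x /AD[F FA xF] M [[cM _] AM]; apply: (cM (vec_of_face F)).
  by apply: AM; exists F.
by rewrite lev_face.
Qed.

Lemma mgen_face1 F : mgen [set vec_of_face F] = gam (powerset F).
Proof.
rewrite -(@mgen_face [set F]%SET).
- by congr mgen; apply/seteqP; split=> [_ ->|_ [G /finset.set1P -> <-]] //;
    exists F => //=; apply/finset.set1P.
- by move=> G H; rewrite !powersetE => GF /fintype.subset_trans; apply.
- move=> G; rewrite powersetE; split=> [|[H /finset.set1P ->]] //.
  by exists F; rewrite // finset.set11.
Qed.

Lemma mfacets_above D a : simplicial_complex D ->
  [set b | mfacets (gam D) b /\ lev a b] =
  [set vec_of_face F | F in [set` [set F in sfacets D | supp a \subset F]%SET]].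
Proof.
move=> cD; rewrite mfacets_gam //; apply/seteqP; split=> [b [[F FD <-]]|b [F]] /=.
  by rewrite lev_face => aF; exists F => //=; rewrite inE; apply/andP.
by rewrite inE => /andP[FD aF] <-; rewrite lev_face; split=> //; exists F.
Qed.

Lemma mem_sstarP D s G : simplicial_complex D ->
  G \in sstar D s <->
  exists2 F, F \in [set F in sfacets D | s \subset F]%SET & G \subset F.
Proof.
move=> cD; rewrite [G \in _]inE; split=> [GsD|[F]].
  have [F FD] := sub_sfacet GsD; rewrite finset.subUset => /andP[GF sF].
  by exists F => //; rewrite inE; apply/andP.
rewrite inE => /andP[/sfacetP[FD _] sF] GF.
by apply: (cD F) => //; rewrite finset.subUset GF.
Qed.

Lemma mstar_gam D a : simplicial_complex D ->
  mstar (gam D) a = gam (sstar D (supp a)).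
Proof.
move=> cD; rewrite /mstar mfacets_above //; apply: mgen_face.
  exact: sstar_complex.
by move=> G; apply: mem_sstarP.
Qed.

(** Subtracting a finite vector from some [vec_of_face F] above it changes nothing, so link and star
    have the same generators. *)
Lemma mlink_gam D a : simplicial_complex D -> finite_vec a ->
  mlink (gam D) a = gam (sstar D (supp a)).
Proof.
move=> cD fa; rewrite -mstar_gam // /mlink /mstar; congr mgen.
rewrite mfacets_gam //; apply/seteqP; split.
  by move=> _ [_ [[F FD <-] aF] <-]; rewrite subv_face //; split=> //; exists F.
move=> _ [[F FD <-] aF]; exists (vec_of_face F); last exact: subv_face.
by split=> //; exists F.
Qed.

Lemma mdel_gam D a : simplicial_complex D ->
  mdel (gam D) a = gam (sfdel D (supp a)).
Proof.
move=> cD; rewrite /mdel.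
rewrite -(@mgen_face [set F in sfacets D | ~~ (supp a \subset F)]%SET (sfdel D (supp a))).
- rewrite mfacets_gam //; congr mgen; apply/seteqP; split.
    move=> _ [[F FD <-]]; rewrite lev_face => /negP aF; exists F => //=.
    by rewrite inE; apply/andP.
  move=> b [F /=]; rewrite inE => /andP[FD aF] <-; rewrite lev_face.
  by split; [exists F | apply/negP].
- exact: sfdel_complex.
- move=> G; split=> [/sfdelP[F [? ? ?]]|[F]].
    by exists F => //; rewrite inE; apply/andP.
  by rewrite inE => /andP[? ?] ?; apply/sfdelP; exists F.
Qed.

(** * Stanley sets and shedding faces of [gam D] *)

Lemma sfacets_sstar D s F : simplicial_complex D ->
  F \in sfacets (sstar D s) <-> F \in sfacets D /\ s \subset F.
Proof.
move=> cD; split=> [/sfacetP[]|[/sfacetP[FD maxF] sF]].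
  rewrite inE => FsD maxF; have sF : s \subset F.
    by rewrite -(maxF (F :|: s)%SET) ?finset.subsetUr ?finset.subsetUl // inE -finset.setUA finset.setUid.
  split=> //; apply/sfacetP; split; first by rewrite -(finset.setUidPl sF).
  move=> G GD FG; apply: maxF => //; rewrite inE.
  by rewrite (finset.setUidPl (fintype.subset_trans sF FG)).
apply/sfacetP; split; first by rewrite inE (finset.setUidPl sF).
by move=> G; rewrite inE => GsD; apply: maxF; apply: cD GsD _; rewrite finset.subsetUl.
Qed.

Lemma sfacets_sfdel D s F : F \in sfacets (sfdel D s) -> F \in sfacets D.
Proof.
move=> /sfacetP[/sfdelP[G [Gfac sG FG]] maxF]; rewrite -(maxF G) //.
by apply/sfdelP; exists G.
Qed.

(** Identifies the Stanley set that occurs in [mshedding_indic]. Adding [indic s] makes the entries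
    on s positive, and any x positive on s is recovered from [subv x (indic s)]. *)
Lemma addv_indic s F : s \subset F ->
  [set addv (indic s) u | u in gam (powerset F)] =
  [set x | s \subset supp x /\ supp x \subset F].
Proof.
move=> sF; apply/seteqP; split=> [y [u]|x [sx xF]].
  rewrite /gam /= powersetE => uF <-; split; apply/fintype.subsetP => i.
    by rewrite inE !ffunE => ->; case: (u i).
  rewrite inE !ffunE; have [/(fintype.subsetP sF)//|_] := boolP (i \in s).
  by have := fintype.subsetP uF i; rewrite inE; case: (u i).
exists (subv x (indic s)).
  rewrite /gam /= powersetE; apply/fintype.subsetP => i ix; apply: (fintype.subsetP xF).
  by move: ix; rewrite !inE !ffunE; case: (x i) => [[|p]|].
apply/ffunP => i; rewrite !ffunE; have := fintype.subsetP sx i; rewrite inE.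
by case: (i \in s) => [/(_ isT)|_]; case: (x i) => [[|p]|] //=;
  rewrite ?subn1 ?subn0.
Qed.

Lemma lev_addv a u : lev a (addv a u).
Proof.
by apply/forallP => i; rewrite ffunE; case: (a i) (u i) => [p|] [q|] //=;
  rewrite leq_addr.
Qed.

(** A Stanley set of degree a lies entirely above a. For a facet F containing [supp a], the vector
    of F minus v is not above a, so it must belong to the deletion; the facet G of D that witnesses
    this supplies w. *)
Lemma sshedding_of_mshedding k D a : simplicial_complex D ->
  mshedding k (gam D) a -> sshedding D (supp a).
Proof.
move=> cD [aD fa _ stan _]; split=> // t tD st v vs.
have [F Ffac tF] := sub_sfacet tD; have /sfacetP[FD maxF] := Ffac.
(* If t is not the whole facet F, any vertex of F outside t serves as w. *)
have [Ft|] := boolP (F \subset t); last first.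
  case/subsetPn=> w wF wt; exists w => //; apply: (cD F) => //.
  rewrite (fintype.subset_trans (subD1set _ _)) // finset.subUset tF.
  by apply/fintype.subsetP => i /finset.set1P ->.
have Et : t = F by apply/eqP; rewrite finset.eqEsubset tF.
subst t => {Ft tF tD}.
have bfac : mfacets (mstar (gam D) a) (vec_of_face F).
  rewrite mstar_gam // mfacets_gam; last exact: sstar_complex.
  by exists F => //; apply/sfacets_sstar.
have [m [_]] := stan _ bfac; rewrite mgen_face1 mdel_gam // => E.
have : (F :\ v)%SET \in sfdel D (supp a).
  apply/negPn/negP => Fv; have : (gam (powerset F) `\` gam (sfdel D (supp a)))
    (vec_of_face (F :\ v)%SET).
    by split; [rewrite gam_face powersetE subD1set | rewrite gam_face; apply/negP].
  rewrite E => -[u _ Eu]; have := lev_addv a u; rewrite {}Eu lev_face.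
  by move=> /fintype.subsetP/(_ v vs); rewrite !inE eqxx.
move=> /sfdelP[G [/sfacetP[GD maxG] aG FvG]].
(* G is not inside F: by maximality it would equal F, which contains [supp a]. *)
have [|w wG wF] := @subsetPn _ G F _.
  apply: contra aG => GF; by rewrite -(maxG F FD GF).
exists w => //; apply: (cD G) => //; apply/fintype.subsetP => i.
rewrite !inE => /andP[iv /orP[iF|/eqP -> //]].
by apply: (fintype.subsetP FvG); rewrite !inE iv.
Qed.

(** By [sfdel_sshedding], a vector below [vec_of_face F] is outside the deletion exactly when its
    support contains s, which is the set of [addv_indic]. For condition (ii), facets of the star and
    of the deletion are all facets of D, so inclusion between them is equality. *)
Lemma mshedding_indic k D s : simplicial_complex D -> sshedding D s ->
  #|s| <= k.+1 -> mshedding k (gam D) (indic s).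
Proof.
move=> cD shed sk; have [sD _] := shed.
have fs : finite_vec (indic s) by move=> i; rewrite ffunE.
rewrite /mshedding mstar_gam // mdel_gam // fpt_star_supp // supp_indic.
rewrite !mfacets_gam; [|exact: sfdel_complex|exact: sstar_complex].
split=> //; first by rewrite /gam /= supp_indic.
- move=> _ [F /(sfacets_sstar _ _ cD)[/sfacetP[FD _] sF] <-].
  exists (vec_of_face F); split.
    by move=> i; rewrite ffunE; case: ifP; [right|left].
  rewrite mgen_face1 addv_indic // sfdel_sshedding //.
  apply/seteqP; split=> x; rewrite /gam /setD /= powersetE inE.
    move=> [xF /negP]; rewrite negb_and negbK => /orP[|//].
    by rewrite (cD F).
  by move=> [sx xF]; rewrite sx andbF.
- move=> _ c [F /(sfacets_sstar _ _ cD)[/sfacetP[FD _] _] <-].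
  move=> [G /sfacets_sfdel/sfacetP[_ maxG] <-].
  by rewrite !fpt_face finset.setCS => GF; rewrite (maxG F).
Qed.

(** * The two inductions over cones *)

(** The apex e is arbitrary because passing to the link enlarges it by s. The void complex is
    excluded, as its multicomplex has no facet. *)
Lemma mkdecomposable_cone k D : skdecomposable k D ->
  forall e, simplicial_complex D -> D != finset.set0 ->
    (forall G, G \in D -> [disjoint G & e]%B) ->
  mkdecomposable k (gam (cone e D)).
Proof.
elim=> {D} [|F|D s shed sk _ IHdel _ IHlink] e cD Dn0 De.
- by rewrite eqxx in Dn0.
- apply: (@mkdec_facet _ _ _ (vec_of_face (F :|: e)%SET)).
  have -> : cone e (powerset F) = powerset (F :|: e)%SET.
    by apply/setP => G; rewrite !inE subDset finset.setUC.
  rewrite mfacets_gam; last first.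
    by move=> G H; rewrite !powersetE => GF /fintype.subset_trans; apply.
  apply/seteqP; split=> [b [G /sfacetP[]]|_ ->].
    by rewrite powersetE => GFe maxG <-; rewrite -(maxG (F :|: e)%SET) // powersetE.
  exists (F :|: e)%SET => //; apply/sfacetP; rewrite powersetE; split=> // G.
  by rewrite powersetE => GFe FeG; apply/eqP; rewrite finset.eqEsubset GFe.
(* Deleting the empty face leaves the void complex, out of reach of [IHdel]; but then the link is D
   itself. *)
have [s0|sn0] := eqVneq s finset.set0.
  by move: IHlink; rewrite s0 slink0; apply.
have [sD _] := shed; have se := De s sD.
have cC := cone_complex (e := e) cD.
have shedC : sshedding (cone e D) s by apply/sshedding_cone.
have D0 : finset.set0 \in D by apply: cD sD (finset.sub0set _).
apply: (mkdec_shed (a := indic s)).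
- exact: mshedding_indic.
- rewrite mlink_gam //; last by move=> i; rewrite ffunE.
  rewrite supp_indic sstar_cone //; apply: IHlink.
  + exact: slink_complex.
  + apply/finset.set0Pn; exists finset.set0; rewrite inE D0 finset.set0U sD.
    by rewrite -setI_eq0 finset.set0I eqxx.
  + move=> G; rewrite inE => /and3P[GD Gs _].
    by rewrite -setI_eq0 finset.setIUr finset.setU_eq0 !setI_eq0 Gs De.
- rewrite mdel_gam // supp_indic sfdel_sshedding // sdel_cone //.
  apply: IHdel.
  + exact: sdel_complex.
  + by apply/finset.set0Pn; exists finset.set0; rewrite inE D0 finset.subset0.
  + by move=> G; rewrite inE => /andP[/De].
Qed.

(** All presentations of [Gam] as a cone are allowed, since the link at a is presented with apex
    enlarged by [supp a]. The vector a is replaced by its support, which avoids e by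
    [sshedding_cone]. *)
Lemma skdecomposable_cone k Gam : mkdecomposable k Gam ->
  forall e D, simplicial_complex D ->
    (forall G, G \in D -> [disjoint G & e]%B) -> Gam = gam (cone e D) ->
  skdecomposable k D.
Proof.
elim=> {Gam} [Gam b Eb|Gam a shed _ IHlink _ IHdel] e D cD De EGam;
  have cC := cone_complex (e := e) cD; subst Gam.
- rewrite mfacets_gam // in Eb.
  have [F Ffac EF] : [set vec_of_face F | F in [set` sfacets (cone e D)]] b.
    by rewrite Eb.
  have FC : F \in cone e D by case/sfacetP: Ffac.
  (* With F as its only facet the cone is a simplex, and D consists of its faces avoiding e. *)
  suff -> : D = powerset (F :\: e)%SET by exact: skdec_simplex.
  apply/setP => G; rewrite powersetE finset.subsetD.
  apply/idP/andP => [GD|[GF Ge]].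
    split; last exact: De.
    have [H Hfac GH] := sub_sfacet (sub_cone e cD GD).
    have : [set vec_of_face F | F in [set` sfacets (cone e D)]] (vec_of_face H).
      by exists H.
    by rewrite Eb /= -EF => /vec_of_face_inj <-.
  have := cC _ _ FC GF; rewrite inE; by move/finset.setDidPl: Ge => ->.
have [_ fa ak _ _] := shed; rewrite fpt_star_supp // in ak.
have shedC := sshedding_of_mshedding cC shed.
have /sshedding_cone[//|//|ae shedD] := shedC.
apply: (skdec_shed shedD ak).
- apply: (IHdel e); first exact: sdel_complex.
    by move=> G; rewrite inE => /andP[/De].
  by rewrite mdel_gam // sfdel_sshedding // sdel_cone.
- apply: (IHlink (supp a :|: e)%SET); first exact: slink_complex.
    move=> G; rewrite inE => /and3P[GD Gs _].
    by rewrite -setI_eq0 finset.setIUr finset.setU_eq0 !setI_eq0 Gs De.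
  by rewrite mlink_gam // sstar_cone.
Qed.

(** Maximal elements are facets, so a multicomplex is the set of vectors below its facets. *)
Lemma multicomplex_gam Gam D : multicomplex Gam ->
    mfacets Gam = [set vec_of_face F | F in [set` sfacets D]] ->
    simplicial_complex D ->
  Gam = gam D.
Proof.
move=> [down max] Efac cD; apply/seteqP; split=> x.
  move=> /max[m mmax xm]; have : mfacets Gam m.
    by split=> [|m' [m'G _] mm']; case: mmax => // mG /(_ _ m'G mm') ->.
  rewrite Efac => -[F /sfacetP[FD _] Em]; move: xm; rewrite -Em lev_face.
  exact: cD.
move=> /sub_sfacet[F Ffac xF]; have : mfacets Gam (vec_of_face F).
  by rewrite Efac; exists F.
by case=> FG _; apply: down FG _; rewrite lev_face.
Qed.

End Support.

Theorem proposition3p9 (n k : nat) (D : {set {set 'I_n}})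
    (Gam : set (vec_oo n)) (D_complex : simplicial_complex D)
    (D_nonvoid : D != finset.set0) (Gam_multicomplex : multicomplex Gam)
    (Gam_facets : mfacets Gam = [set vec_of_face F | F in [set` sfacets D]]) :
  skdecomposable k D <-> mkdecomposable k Gam.
Proof.
rewrite (multicomplex_gam Gam_multicomplex Gam_facets D_complex).
have disj0 (G : {set 'I_n}) : G \in D -> [disjoint G & finset.set0]%B.
  by move=> _; rewrite -setI_eq0 finset.setI0.
split=> [skD|mkD].
  by rewrite -(cone0 D); apply: mkdecomposable_cone.
by apply: (skdecomposable_cone mkD D_complex disj0); rewrite cone0.
Qed.
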